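(* Let $K$ be the digraph with vertex set $\{a,b,c,d\}$ whose sides are exactly: an edge between $a$ and $b$, an edge between $c$ and $d$, and the four arrows $a\to c$, $a\to d$, $b\to c$, $b\to d$. Then, up to isomorphism of digraphs, $K$ is the only acyclic digraph of infinite type with four vertices. That is, for an acyclic digraph $Q$ with exactly four vertices, the monoid $H_Q$ is infinite if and only if $Q$ is isomorphic to $K$.
   Context: A digraph $Q$ is a graph with at most one connection (side) between each pair of distinct vertices and no loops; each side is either an oriented arrow $i\to j$ or a non-oriented edge. The Hecke-Kiselman monoid $H_Q$ is the monoid generated by elements $a_i$, one for each vertex $i$ of $Q$, subject to the relations: $a_i^2=a_i$ for all $i$; $a_ia_j=a_ja_i$ if $i,j$ are not connected; $a_ia_ja_i=a_ja_ia_j$ if $i,j$ are connected by an edge; $a_ia_j=a_ia_ja_i=a_ja_ia_j$ if there is an arrow from $i$ to $j$. The digraph $Q$ is of finite type if $H_Q$ is finite, and of infinite type otherwise. A cycle in $Q$ is a sequence $(v_i)_{i\in\mathbb{Z}/n\mathbb{Z}}$, $n\ge 3$, of pairwise distinct vertices such that for each $i\in\mathbb{Z}/n\mathbb{Z}$ there is in $Q$ either an edge between $v_i$ and $v_{i+1}$ or an arrow from $v_i$ to $v_{i+1}$. $Q$ is acyclic if it contains no cycles. *)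

(* Defs.v *)
From HB Require Import structures.
From mathcomp Require Import all_boot.
From mathcomp Require Import boolp classical_sets cardinality.

Set Implicit Arguments.
Unset Strict Implicit.
Unset Printing Implicit Defensive.

Local Open Scope quotient_scope.
Local Open Scope classical_set_scope.

Inductive gen_congr (T : Type) (r : seq T -> seq T -> Prop) :
    seq T -> seq T -> Prop :=
| gen_congr_base u v of r u v : gen_congr r u v
| gen_congr_refl u : gen_congr r u u
| gen_congr_sym u v of gen_congr r u v : gen_congr r v u
| gen_congr_trans u v w of gen_congr r u v & gen_congr r v w : gen_congr r u w
| gen_congr_cat u u' v v' of gen_congr r u v & gen_congr r u' v' :
    gen_congr r (u ++ u') (v ++ v').

Definition gen_congrb (T : choiceType) (r : seq T -> seq T -> Prop) :
  rel (seq T) := fun u v => `[< gen_congr r u v >].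

Lemma gen_congrb_refl (T : choiceType) (r : seq T -> seq T -> Prop) :
  reflexive (gen_congrb r).
Proof. by move=> u; apply/asboolP; apply: gen_congr_refl. Qed.

Lemma gen_congrb_sym (T : choiceType) (r : seq T -> seq T -> Prop) :
  symmetric (gen_congrb r).
Proof. by move=> u v; apply/asboolP/asboolP; apply: gen_congr_sym. Qed.

Lemma gen_congrb_trans (T : choiceType) (r : seq T -> seq T -> Prop) :
  transitive (gen_congrb r).
Proof.
move=> v u w /asboolP uv /asboolP vw; apply/asboolP.
exact: gen_congr_trans uv vw.
Qed.

Canonical gen_congr_equiv (T : choiceType) (r : seq T -> seq T -> Prop) :=
  EquivRel (gen_congrb r) (gen_congrb_refl r) (gen_congrb_sym r)
    (gen_congrb_trans (r := r)).

(* The monoid < T | u = v for all u, v such that r u v >. *)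
Definition presented_monoid (T : choiceType) (r : seq T -> seq T -> Prop) :=
  {eq_quot gen_congr_equiv r}.

HB.instance Definition _ (T : choiceType) (r : seq T -> seq T -> Prop) :=
  Choice.on (presented_monoid r).
HB.instance Definition _ (T : choiceType) (r : seq T -> seq T -> Prop) :=
  EqQuotient.on (presented_monoid r).

Lemma presented_eqP (T : choiceType) (r : seq T -> seq T -> Prop)
    (u v : seq T) :
  u = v %[mod presented_monoid r] <-> gen_congr r u v.
Proof.
split; first by move/eqmodP/asboolP.
by move=> ruv; apply/eqmodP/asboolP.
Qed.

Definition presented_mul (T : choiceType) (r : seq T -> seq T -> Prop)
    (x y : presented_monoid r) : presented_monoid r :=
  \pi_(presented_monoid r) (repr x ++ repr y).

Lemma presented_mul_pi (T : choiceType) (r : seq T -> seq T -> Prop)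
    (u v : seq T) :
  presented_mul (\pi_(presented_monoid r) u) (\pi_(presented_monoid r) v)
  = \pi_(presented_monoid r) (u ++ v).
Proof.
by apply/presented_eqP; apply: gen_congr_cat; apply/presented_eqP;
  rewrite reprK.
Qed.

Lemma presented_mulA (T : choiceType) (r : seq T -> seq T -> Prop) :
  associative (@presented_mul T r).
Proof.
move=> x y z; rewrite -(reprK x) -(reprK y) -(reprK z).
rewrite (presented_mul_pi r (repr y) (repr z)).
rewrite (presented_mul_pi r (repr x) (repr y)).
by rewrite 2!presented_mul_pi catA.
Qed.

Lemma presented_mul1 (T : choiceType) (r : seq T -> seq T -> Prop) :
  left_id (\pi_(presented_monoid r) [::]) (@presented_mul T r).
Proof. by move=> x; rewrite -(reprK x) presented_mul_pi. Qed.

Lemma presented_mulr1 (T : choiceType) (r : seq T -> seq T -> Prop) :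
  right_id (\pi_(presented_monoid r) [::]) (@presented_mul T r).
Proof. by move=> x; rewrite -(reprK x) presented_mul_pi cats0. Qed.

HB.instance Definition _ (T : choiceType) (r : seq T -> seq T -> Prop) :=
  isMonoid.Build (presented_monoid r) (@presented_mulA T r)
    (@presented_mul1 T r) (@presented_mulr1 T r).

(* [digraph_arrow_side] forbids a second side between the endpoints of an
   arrow; taken at x = y it also forbids arrows that are loops. *)
Record digraph := Digraph {
  vertex :> finType;
  arrow : rel vertex;
  edge : rel vertex;
  digraph_edge_sym : symmetric edge;
  digraph_edge_irr : irreflexive edge;
  digraph_arrow_side : forall x y, arrow x y -> ~~ arrow y x && ~~ edge x y
}.

Definition connected (Q : digraph) : rel Q :=
  fun x y => [|| edge x y, arrow x y | arrow y x].

Definition digraph_iso (Q Q' : digraph) : Prop :=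
  exists f : Q -> Q', [/\ bijective f,
    {mono f : x y / arrow x y >-> arrow x y} &
    {mono f : x y / edge x y >-> edge x y}].

(* [ucycle] is a duplicate-free sequence whose consecutive elements, including
   the last and the first, are related. *)
Definition acyclic (Q : digraph) : Prop :=
  ~ exists s : seq Q, 2 < size s /\ ucycle (fun x y => edge x y || arrow x y) s.

Inductive HK_rel (Q : digraph) : seq Q -> seq Q -> Prop :=
| HK_idem i : HK_rel [:: i; i] [:: i]
| HK_comm i j of i != j & ~~ connected i j : HK_rel [:: i; j] [:: j; i]
| HK_edge i j of edge i j : HK_rel [:: i; j; i] [:: j; i; j]
| HK_arrow_l i j of arrow i j : HK_rel [:: i; j] [:: i; j; i]
| HK_arrow_r i j of arrow i j : HK_rel [:: i; j; i] [:: j; i; j].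

Definition HK_monoid (Q : digraph) : monoidType := presented_monoid (@HK_rel Q).

Definition infinite_type (Q : digraph) : Prop :=
  infinite_set [set: HK_monoid Q].

(* The vertices a, b, c, d are 0, 1, 2, 3. *)
Definition K_arrow : rel 'I_4 := fun x y =>
  (val x, val y) \in [:: (0, 2); (0, 3); (1, 2); (1, 3)].

Definition K_edge : rel 'I_4 := fun x y =>
  (val x, val y) \in [:: (0, 1); (1, 0); (2, 3); (3, 2)].

Lemma K_edge_sym : symmetric K_edge.
Proof. by case=> [[|[|[|[|x]]]] hx] [[|[|[|[|y]]]] hy]. Qed.

Lemma K_edge_irr : irreflexive K_edge.
Proof. by case=> [[|[|[|[|x]]]] hx]. Qed.

Lemma K_arrow_side x y : K_arrow x y -> ~~ K_arrow y x && ~~ K_edge x y.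
Proof. by case: x y => [[|[|[|[|x]]]] hx] [[|[|[|[|y]]]] hy]. Qed.

Definition K : digraph := Digraph K_edge_sym K_edge_irr K_arrow_side.

(* Main.v *)
From Stdlib Require Import NArith Ascii String.
Require Import Defs.
From mathcomp Require Import all_boot.
From mathcomp Require Import zify.
From mathcomp Require Import boolp classical_sets cardinality.

(* K is infinite because the powers of acbd are pairwise distinct in H_K: the
   monoid acts on an infinite set by counting alternating blocks ac and bd.
   In the other direction, a vertex all of whose sides are outgoing arrows can be
   erased from a word after its first occurrence (v w v = v w), and dually for
   incoming ones, so removing such a vertex does not affect finiteness. An
   acyclic digraph on four vertices other than K without such a vertex becomes,
   after adding sides or replacing arrows by edges, A_4, D_4 or K minus an arrow;
   both operations enlarge the monoid. After removals only A_3 and A_2 occur.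
   These five monoids are finite because finitely many words avoid the left-hand
   sides of some length-lexicographically decreasing consequences of the
   relations, each given with a derivation. *)

Set Implicit Arguments.
Unset Strict Implicit.
Unset Printing Implicit Defensive.

(** * Congruences generated by relations: contexts, actions and images *)

Section Congruence.
Variables (T : Type) (r : seq T -> seq T -> Prop).

Lemma gen_congr_ctx p s u v :
  gen_congr r u v -> gen_congr r (p ++ u ++ s) (p ++ v ++ s).
Proof.
move=> uv; apply: gen_congr_cat; first exact: gen_congr_refl.
by apply: gen_congr_cat => //; exact: gen_congr_refl.
Qed.

(** An action that respects the relations is a tool to tell non-congruent words apart. *)
Lemma gen_congr_foldl (X : Type) (act : X -> T -> X) :
  (forall u v x, r u v -> foldl act x u = foldl act x v) ->
  forall u v x, gen_congr r u v -> foldl act x u = foldl act x v.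
Proof.
move=> ract u v x uv; elim: uv x => //.
- by move=> {}u {}v ruv x; exact: ract.
- by move=> {}u {}v w _ IHuv _ IHvw x; rewrite IHuv IHvw.
- by move=> {}u u' {}v v' _ IHuv _ IHuv' x; rewrite !foldl_cat IHuv IHuv'.
Qed.

End Congruence.

Lemma gen_congr_map (T T' : Type) (f : T -> T') (r : seq T -> seq T -> Prop)
    (r' : seq T' -> seq T' -> Prop) :
  (forall u v, r u v -> gen_congr r' (map f u) (map f v)) ->
  forall u v, gen_congr r u v -> gen_congr r' (map f u) (map f v).
Proof.
move=> rr' u v; elim=> //.
- by move=> w; exact: gen_congr_refl.
- by move=> {}u {}v _; exact: gen_congr_sym.
- by move=> {}u {}v w _ uv _; exact: gen_congr_trans.
- by move=> {}u u' {}v v' _ uv _ uv'; rewrite !map_cat; exact: gen_congr_cat.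
Qed.

(** * Finitely spanned sets of vertices and the removal of sources and sinks *)

Section HeckeKiselman.
Variable Q : digraph.
Implicit Types (i j v : Q) (w : seq Q) (S : pred Q).

Local Notation "u ~~~ w" := (gen_congr (@HK_rel Q) u w) (at level 70).

Lemma HK_comm_gen i j : ~~ connected i j -> [:: i; j] ~~~ [:: j; i].
Proof.
have [-> _|ij nij] := eqVneq i j; first exact: gen_congr_refl.
by apply: gen_congr_base; exact: HK_comm.
Qed.

Lemma HK_idem_gen i : [:: i; i] ~~~ [:: i].
Proof. by apply: gen_congr_base; exact: HK_idem. Qed.

(* The relations of an arrow i -> j also hold if i and j are not connected. *)
Lemma HK_arrow_gen i j : ~~ edge i j -> ~~ arrow j i ->
  [:: i; j; i] ~~~ [:: i; j] /\ [:: j; i; j] ~~~ [:: i; j].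
Proof.
move=> ne na; have [aij|nij] := boolP (arrow i j).
  have iji : [:: i; j; i] ~~~ [:: i; j].
    by apply/gen_congr_sym/gen_congr_base; exact: HK_arrow_l.
  split=> //; apply: gen_congr_trans iji.
  by apply/gen_congr_sym/gen_congr_base; exact: HK_arrow_r.
have ij : [:: i; j] ~~~ [:: j; i].
  by apply: HK_comm_gen; rewrite /connected negb_or ne negb_or nij.
split.
  apply: gen_congr_trans (gen_congr_ctx [:: i] [::] (gen_congr_sym ij)) _.
  exact: (gen_congr_ctx [::] [:: j] (HK_idem_gen i)).
apply: gen_congr_trans (gen_congr_ctx [::] [:: j] (gen_congr_sym ij)) _.
exact: (gen_congr_ctx [:: i] [::] (HK_idem_gen j)).
Qed.

(** Without an edge, both sides equal the product of the two letters, taken along the arrow if there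
    is one. Hence an edge is the weakest side. *)
Lemma HK_braid_gen i j : [:: i; j; i] ~~~ [:: j; i; j].
Proof.
have [e|ne] := boolP (edge i j); first by apply: gen_congr_base; exact: HK_edge.
have [aji|naji] := boolP (arrow j i).
  have [||jij iji] := @HK_arrow_gen j i.
  - by rewrite digraph_edge_sym.
  - by case/andP: (digraph_arrow_side aji).
  - exact: gen_congr_trans iji (gen_congr_sym jij).
have [iji jij] := HK_arrow_gen ne naji.
exact: gen_congr_trans iji (gen_congr_sym jij).
Qed.

(** This expresses that the submonoid generated by [S] is finite. *)
Definition span_finite S := exists L : seq (seq Q),
  forall w, all S w -> exists2 u, u \in L & u ~~~ w.

Lemma sub_span_finite S S' :
  (forall i, S i -> S' i) -> span_finite S' -> span_finite S.
Proof.
move=> SS' [L hL]; exists L => w wS.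
by apply: hL; apply: sub_all wS.
Qed.

Lemma span_finite_predT : span_finite predT -> ~ infinite_type Q.
Proof.
case=> L hL; apply.
apply: sub_finite_set (finite_image (fun w => \pi_(HK_monoid Q)%qT w)
  (finite_seq L)).
move=> x _; have [|u uL ux] := hL (repr x); first exact: all_predT.
by exists u => //; rewrite -[RHS]reprK; apply/presented_eqP.
Qed.

(** Reading from left to right, each further [v] is merged with the previous one, so every word
    becomes one with at most one [v]. The form [u ++ v :: w'] covers sources ([u] empty) and sinks
    ([w'] empty) at once. *)
Lemma span_finite_absorb S v :
  (forall w, all S w ->
     exists u w', [/\ all S u, all S w' & v :: rcons w v ~~~ u ++ v :: w']) ->
  span_finite S -> span_finite (predU1 v S).
Proof.
move=> absv [L hL].
pose L' := L ++ [seq x ++ v :: y | x <- L, y <- L].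
suff nf w : all (predU1 v S) w -> exists u, all S u /\
    (u ~~~ w \/ exists2 w', all S w' & u ++ v :: w' ~~~ w).
  exists L' => w /nf[u [uS [uw|[w' w'S uw']]]].
    have [x xL xu] := hL _ uS; exists x; first by rewrite mem_cat xL.
    exact: gen_congr_trans xu uw.
  have [x xL xu] := hL _ uS; have [y yL yw] := hL _ w'S.
  exists (x ++ v :: y).
    by rewrite mem_cat; apply/orP; right; apply: allpairs_f.
  apply: gen_congr_trans uw'; apply: gen_congr_cat => //.
  by have := gen_congr_ctx [:: v] [::] yw; rewrite !cats0.
elim/last_ind: w => [_|w j IHw].
  by exists [::]; split=> //; left; exact: gen_congr_refl.
rewrite all_rcons => /andP[/predU1P jS /IHw[u [uS uw]]].
have appj x : x ~~~ w -> rcons x j ~~~ rcons w j.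
  by move=> xw; rewrite -!cats1; apply: gen_congr_cat => //;
    exact: gen_congr_refl.
case: jS uw => [-> | jS] [uw|[w' w'S uw']] in appj *.
- exists u; split=> //; right; exists [::] => //.
  by rewrite cats1; exact: appj.
- have [x [y [xS yS xy]]] := absv _ w'S.
  exists (u ++ x); split; first by rewrite all_cat uS.
  right; exists y => //.
  apply: gen_congr_trans (appj _ uw'); rewrite rcons_cat -catA /=.
  by apply/gen_congr_cat/gen_congr_sym => //; exact: gen_congr_refl.
- exists (rcons u j); split; first by rewrite all_rcons jS.
  by left; exact: appj.
- exists u; split=> //; right; exists (rcons w' j).
    by rewrite all_rcons jS.
  by have := appj _ uw'; rewrite rcons_cat.
Qed.

(** By induction on [w]: v j w v = v j v w v = v j v w = v j w. *)
Lemma span_finite_source S v : (forall j, S j -> ~~ edge v j && ~~ arrow j v) ->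
  span_finite S -> span_finite (predU1 v S).
Proof.
move=> src; apply: span_finite_absorb => w wS; exists [::], w; split=> //.
elim: w wS => [_|j w IHw /= /andP[/src/andP[ne na] /IHw vw]].
  exact: HK_idem_gen.
have [vjv _] := HK_arrow_gen ne na.
apply: gen_congr_trans (gen_congr_ctx [::] (rcons w v) (gen_congr_sym vjv)) _.
apply: gen_congr_trans (gen_congr_ctx [::] w vjv).
by have := gen_congr_ctx [:: v; j] [::] vw; rewrite !cats0.
Qed.

(** Dually, v w j v = v w v j v = w v j v = w j v. *)
Lemma span_finite_sink S v : (forall j, S j -> ~~ edge v j && ~~ arrow v j) ->
  span_finite S -> span_finite (predU1 v S).
Proof.
move=> snk; apply: span_finite_absorb => w wS; exists w, [::]; split=> //.
elim/last_ind: w wS => [_|w j IHw]; first exact: HK_idem_gen.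
rewrite all_rcons => /andP[/snk/andP[ne na] /IHw vw].
have [|_ vjv] := @HK_arrow_gen j v _ na; first by rewrite digraph_edge_sym.
rewrite -!cats1 -!catA /=.
apply: gen_congr_trans (gen_congr_ctx (v :: w) [::] (gen_congr_sym vjv)) _.
have /= := gen_congr_ctx [::] [:: j; v] vw.
rewrite -cats1 -!catA /= => vwv; apply: gen_congr_trans vwv _.
exact: (gen_congr_ctx w [::] vjv).
Qed.

End HeckeKiselman.

(** * Rewriting certificates for finiteness *)

Section Rewriting.
Variables (k : nat) (B : seq (seq nat * seq nat)).
Implicit Types (w : seq nat) (rules : seq (seq nat * seq nat)).

Local Notation "u ~~~ w" :=
  (gen_congr (fun x y => (x, y) \in B) u w) (at level 70).

Definition one_step w : seq (seq nat) :=
  [seq take i w ++ p.2 ++ drop (i + size p.1) w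
     | i <- iota 0 (size w).+1, p <- [seq p <- B | prefix p.1 (drop i w)]].

Definition derivation (c : seq (seq nat)) : bool :=
  if c is w :: c' then
    path (fun u v => (v \in one_step u) || (u \in one_step v)) w c'
  else true.

Definition conclusion (c : seq (seq nat)) := (head [::] c, last [::] c).

(* With digits 1, 2, ... in base 5, the code respects the length-lexicographic
   order on the words over at most four letters. *)
Definition code w : N := foldl (fun n i => n * 5 + N.of_nat i + 1)%num 0%num w.

Definition decreasing (p : seq nat * seq nat) : bool :=
  [&& size p.2 <= size p.1, N.ltb (code p.2) (code p.1) & all (gtn k) p.2].

(** Words of length [n] are built by prepending letters to irreducible ones, so a left-hand side can
    only occur as a prefix. *)
Fixpoint irreducible rules n : seq (seq nat) :=
  if n is n'.+1 then
    let ws := irreducible rules n' in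
    [seq w <- [seq i :: w | i <- iota 0 k, w <- ws]
       | ~~ has (fun p => prefix p.1 w) rules]
  else [:: [::]].

Definition finiteness_certificate (cs : seq (seq (seq nat))) n : bool :=
  let rules := B ++ map conclusion cs in
  [&& all derivation cs, all decreasing rules & irreducible rules n == [::]].

Lemma one_step_congr u w : w \in one_step u -> u ~~~ w.
Proof.
case/allpairsPdep=> i [[l r] [_]]; rewrite mem_filter /=.
move=> /andP[/prefixP[s us]] lr ->.
rewrite -{1}(cat_take_drop i u) us addnC -drop_drop us.
rewrite drop_size_cat //.
by apply: gen_congr_ctx; exact: gen_congr_base.
Qed.

Lemma derivation_congr c :
  derivation c -> (conclusion c).1 ~~~ (conclusion c).2.
Proof.
case: c => [_|u c /=]; first exact: gen_congr_refl.
elim: c u => [|w c IHc] u /=; first by move=> _; exact: gen_congr_refl.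
case/andP=> uw /IHc; apply: gen_congr_trans.
by case/orP: uw => /one_step_congr // /gen_congr_sym.
Qed.

Lemma codeE u w : code (u ++ w) = (code u * 5 ^ N.of_nat (size w) + code w)%num.
Proof.
elim/last_ind: w => [|w i IHw]; first by rewrite cats0 N.mul_1_r N.add_0_r.
rewrite -rcons_cat /code !foldl_rcons -!/(code _) IHw size_rcons.
rewrite Nnat.Nat2N.inj_succ N.pow_succ_r'; ring.
Qed.

Lemma code_ctx l r p s : size r <= size l -> N.lt (code r) (code l) ->
  N.lt (code (p ++ r ++ s)) (code (p ++ l ++ s)).
Proof.
move=> rl crl; rewrite !codeE !size_cat.
have le_pow : N.le (5 ^ N.of_nat (size r + size s))
    (5 ^ N.of_nat (size l + size s)).
  by apply: N.pow_le_mono_r; lia.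
have pos : N.lt 0 (5 ^ N.of_nat (size s)) by apply/N.neq_0_lt_0/N.pow_nonzero.
nia.
Qed.

Lemma irreducible_or_reducible rules w : all (gtn k) w ->
  w \in irreducible rules (size w) \/
  exists p l r s, (l, r) \in rules /\ w = p ++ l ++ s.
Proof.
elim: w => [|i w IHw] /=; first by left; rewrite inE.
case/andP=> ik /IHw[wirr|[p [l [r [s [lr ->]]]]]]; last first.
  by right; exists (i :: p), l, r, s.
have [/hasP[[l r] lr /prefixP[s ->]]|red] :=
    boolP (has (fun p => prefix p.1 (i :: w)) rules).
  by right; exists [::], l, r, s.
by left; rewrite mem_filter red; apply: allpairs_f => //; rewrite mem_iota.
Qed.

Lemma irreducible_bounded rules n m :
  irreducible rules n = [::] -> n <= m -> irreducible rules m = [::].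
Proof.
move=> n0 /subnK <-; elim: (m - n) => [|d IHd] //=.
by rewrite IHd; elim: (iota 0 k).
Qed.

(** Strong induction on the code: a rule lowers it and preserves both the alphabet and the class, so
    rewriting ends in an irreducible word, of length below [n]. *)
Lemma rewriting_finite cs n : finiteness_certificate cs n ->
  exists L : seq (seq nat),
    forall w, all (gtn k) w -> exists2 u, u \in L & u ~~~ w.
Proof.
case/and3P; set rules := B ++ _ => /allP der /allP dec /eqP irr0.
exists (flatten [seq irreducible rules m | m <- iota 0 n]) => w.
have [m] := ubnP (N.to_nat (code w)); elim: m w => // m IHm w wm wk.
have [wirr|[p [l [r [s [lr wE]]]]]] := irreducible_or_reducible rules wk.
  exists w; last exact: gen_congr_refl.
  apply/flatten_mapP; exists (size w) => //.
  rewrite mem_iota /= add0n ltnNge; apply/negP=> nw.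
  by rewrite (irreducible_bounded irr0 nw) in wirr.
have /and3P[/= rl /N.ltb_lt crl rk] := dec _ lr.
have lrB : l ~~~ r.
  move: lr; rewrite mem_cat => /orP[lr|/mapP[c /der/derivation_congr + lrE]].
    exact: gen_congr_base.
  by rewrite -lrE.
have ltN x y : N.lt x y -> N.to_nat x < N.to_nat y by lia.
have [||u uL uprs] := IHm (p ++ r ++ s).
- by have := code_ctx p s rl crl; rewrite -wE => /ltN/leq_trans; exact.
- by move: wk; rewrite wE !all_cat rk => /and3P[-> _ ->].
exists u => //; apply: gen_congr_trans uprs _.
by rewrite wE; apply/gen_congr_ctx/gen_congr_sym.
Qed.

End Rewriting.

(** * Digraph patterns and their finiteness certificates *)

Record pattern := Pattern {
  psize : nat;
  pedges : seq (nat * nat);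
  parrows : seq (nat * nat)
}.

(** Used for [i < j] only; each relation is oriented so as to be length-lexicographically
    decreasing. *)
Definition side_rels (P : pattern) i j : seq (seq nat * seq nat) :=
  if (i, j) \in pedges P then [:: ([:: j; i; j], [:: i; j; i])]
  else if (i, j) \in parrows P then
    [:: ([:: i; j; i], [:: i; j]); ([:: j; i; j], [:: i; j])]
  else [:: ([:: j; i], [:: i; j])].

Definition pattern_rels (P : pattern) : seq (seq nat * seq nat) :=
  [seq ([:: i; i], [:: i]) | i <- iota 0 (psize P)] ++
  flatten [seq side_rels P p.1 p.2
    | p <- [seq (i, j) | i <- iota 0 (psize P), j <- iota 0 (psize P)]
    & p.1 < p.2].

Definition finite_pattern (P : pattern) :=
  exists L : seq (seq nat), forall w, all (gtn (psize P)) w ->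
    exists2 u, u \in L & gen_congr (fun x y => (x, y) \in pattern_rels P) u w.

(* Every relation of the pattern holds for the vertices f 0, f 1, ...: deleting
   a side or orienting an edge only adds relations to the monoid. *)
Definition dominated (T : Type) (ed ar : rel T) (P : pattern) (f : nat -> T) :=
  all (fun p => (p.1 < p.2) ==>
        ((p \in pedges P) ||
         [&& ~~ ed (f p.1) (f p.2), ~~ ar (f p.2) (f p.1) &
             (p \in parrows P) || ~~ ar (f p.1) (f p.2)]))
    [seq (i, j) | i <- iota 0 (psize P), j <- iota 0 (psize P)].

Lemma dominated_rels (Q : digraph) P (f : nat -> Q) u w :
  dominated (@edge Q) (@arrow Q) P f -> (u, w) \in pattern_rels P ->
  gen_congr (@HK_rel Q) (map f u) (map f w).
Proof.
move=> /allP domP; rewrite mem_cat => /orP[/mapP[i _ [-> ->]]|].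
  exact: HK_idem_gen.
case/flatten_mapP=> [[i j]]; rewrite mem_filter => /andP[/= ij /domP /=].
rewrite ij /side_rels /=; case: ifP => [_ _|_ /= /and3P[ne na]].
  by rewrite inE => /eqP[-> ->]; exact: HK_braid_gen.
have [iji jij] := HK_arrow_gen ne na.
case: ifP => [_ _|_ /= na'].
  by rewrite !inE => /orP[] /eqP[-> ->].
rewrite inE => /eqP[-> ->]; apply: HK_comm_gen.
by rewrite /connected digraph_edge_sym !negb_or ne na na'.
Qed.

Lemma dominated_span_finite (Q : digraph) P (f : nat -> Q) :
  finite_pattern P -> dominated (@edge Q) (@arrow Q) P f ->
  span_finite (fun x => x \in map f (iota 0 (psize P))).
Proof.
move=> [L hL] domP; exists (map (map f) L) => w wS.
pose s := map f (iota 0 (psize P)).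
(* Taking indices in [s] lifts a word over the image of [f] to a word over numbers. *)
have ws : map f (map (index^~ s) w) = w.
  rewrite -map_comp -[RHS]map_id; apply/eq_in_map => x /(allP wS) xs /=.
  have xk : index x s < psize P by rewrite -index_mem size_map size_iota in xs.
  rewrite -[RHS](nth_index x xs) (nth_map 0) ?size_iota //.
  by rewrite nth_iota.
have [|u uL uw] := hL (map (index^~ s) w).
  rewrite all_map; apply/allP=> x /(allP wS) /=.
  by rewrite -index_mem size_map size_iota.
exists (map f u); first exact: map_f.
rewrite -ws; apply: gen_congr_map uw => x y; exact: dominated_rels.
Qed.

(** 97 is the ASCII code of the letter a. *)
Definition letter (c : ascii) : nat := nat_of_ascii c - 97.

Local Open Scope string_scope.

(* The words a...d, separated by spaces, over the letters 0...3. *)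
Fixpoint words (s : string) : seq (seq nat) :=
  match s with
  | EmptyString => [:: [::]]
  | String c s' =>
    if Ascii.eqb c " " then [::] :: words s'
    else if words s' is w :: ws then (letter c :: w) :: ws else [::]
  end.

Lemma certified_pattern P cs n :
  finiteness_certificate (psize P) (pattern_rels P) (map words cs) n ->
  finite_pattern P.
Proof. exact: rewriting_finite. Qed.

(** [A2], [A3], [A4] and [D4] give 0-Hecke monoids of Coxeter groups with longest elements of
    lengths 3, 6, 10 and 12; their certificates use bounds larger by one. *)
Definition A2 := Pattern 2 [:: (0, 1)] [::].

Definition A3 := Pattern 3 [:: (0, 1); (1, 2)] [::].

Definition A4 := Pattern 4 [:: (0, 1); (1, 2); (2, 3)] [::].

Definition D4 := Pattern 4 [:: (0, 1); (0, 2); (0, 3)] [::].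

(** The missing arrow is the one from b to d; the symmetries of [K] permute its four arrows
    transitively. *)
Definition K_minus := Pattern 4 [:: (0, 1); (2, 3)] [:: (0, 2); (0, 3); (1, 2)].

Lemma finite_A2 : finite_pattern A2.
Proof.
apply: (@certified_pattern _ [::] 4).
by vm_compute.
Qed.

Lemma finite_A3 : finite_pattern A3.
Proof.
apply: (@certified_pattern _ [::
  "cbac cbca bcba"] 7).
by vm_compute.
Qed.

Lemma finite_A4 : finite_pattern A4.
Proof.
apply: (@certified_pattern _ [::
  "cbac cbca bcba";
  "dcbd dcdb cdcb";
  "dcbad dcbda dcdba cdcba"] 11).
by vm_compute.
Qed.

Lemma finite_D4 : finite_pattern D4.
Proof.
apply: (@certified_pattern _ [::
  "caba cbab bcab";
  "cabc cacb acab";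
  "daba dbab bdab";
  "dabd dadb adab";
  "daca dcac cdac";
  "dacd dadc adac";
  "dabcd dabdc dadbc adabc";
  "dabcab dacbab dacaba dcacba cdacba cdabca";
  "dabcada dabcdad dabdcad dadbcad adabcad"] 13).
by vm_compute.
Qed.

Lemma finite_K_minus : finite_pattern K_minus.
Proof.
apply: (@certified_pattern _ [::
  "acda acada acad acd";
  "adca adaca adac adc";
  "bdcb dbcb dbc bdc";
  "cabc cacbc acbc abc";
  "cbac cbcac bcac bac";
  "daba dbab bdab";
  "dabd dadb adb abd";
  "dcbd dcdb cdcb";
  "abdab adbab adaba adba abda";
  "acdca acadca acadaca acadac acadc acdc";
  "cabac cabcac cacbcac acbcac abcac abac";
  "dacdc dadcd adcd acdc";
  "abadcb babdcb badbcb badbc babdc abadc";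
  "abdacb adbacb adabacb adbabcb adbabc adabac adbac abdac";
  "acbdab acabdab acadbab acadaba acadba acdba acbda";
  "bdabca dbabca dabaca dabac dbabc bdabc";
  "dabcdc dabdcd dadbcd adbcd abdcd abcdc";
  "dacbdc dacdbc dacdcbc dadcdbc adcdbc acdcbc acdbc acbdc";
  "acbadcb acabadcb acbabdcb acbadbcb acbadbc acbabdc acabadc acbadc";
  "acbdacb acabdacb acadbacb acadabacb acadbabcb acadbabc acadabac acadbac acdbac acbdac";
  "bcdabca bcbdabca bcdbabca bcdabaca bcdabac bcdbabc bcbdabc bcdabc";
  "adcbadcb adacbadcb adacabadcb adacbabdcb adacbadbcb adacbadbc adacbabdc adacabadc adacbadc adcbadc";
  "bcdabcda bcbdabcda bcdbabcda bcdabacda bcdabacada bcdabacad bcdabacd bcdbabcd bcbdabcd bcdabcd";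
  "bdcabdca dbcabdca dbcbabdca dbcabadca dbcabadaca dbcabadac dbcabadc dbcbabdc dbcabdc bdcabdc"] 17).
by vm_compute.
Qed.

Local Close Scope string_scope.

(** * The action of H_K *)

(* Reading a word from left to right, the blocks ac and bd are expected in turn.
   The first component counts the completed blocks; the second one is 0 at the
   beginning of a block, 1 if reading its second letter completes it, and 2 if
   its second letter has come too early. Within a block, a letter of the other
   one leads to [None], unless it is absorbed as in bdcb = bdc or acda = acd. *)
Definition K_act (s : option (nat * nat)) (g : 'I_4) : option (nat * nat) :=
  if s is Some (n, k) then
    if odd g == odd n then
      Some (if g < 2 then (n, 1) else if k == 1 then (n.+1, 0) else (n, 2))
    else if (k == 0) || (1 < k) && (g < 2) then s else None
  else None.

Lemma K_act_rel (u v : seq K) s :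
  HK_rel u v -> foldl K_act s u = foldl K_act s v.
Proof.
case: s => [[n k]|]; last by case.
case=> [i|i j _ /= e|i j /= e|i j /= e|i j /= e].
1: case: i => [[|[|[|[|i]]]] hi] //.
(* Any two distinct vertices of [K] are connected, so commutation leaves no case. *)
5-8: move: e; case: i j => [[|[|[|[|i]]]] hi] [[|[|[|[|j]]]] hj] // _.
(* Only the parity of [n], and whether [k] is 0, 1 or larger, affect the action. *)
all: rewrite /K_act /=; case on: (odd n); case: k => [|[|k]];
  by do 4?rewrite /= ?on.
Qed.

Lemma iso_K_infinite (Q : digraph) : digraph_iso Q K -> infinite_type Q.
Proof.
case=> f [[g fK gK] arrowf edgef].
pose ev (w : seq Q) := foldl K_act (Some (0, 0)) (map f w).
have ev_congr u v : gen_congr (@HK_rel Q) u v -> ev u = ev v.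
  move=> uv; apply: (gen_congr_foldl (fun u v s => @K_act_rel u v s)).
  apply: gen_congr_map uv => {}u {}v uv; apply: gen_congr_base.
  case: uv => [i|i j ij nc|i j e|i j a|i j a] /=.
  - exact: HK_idem.
  - apply: HK_comm; first by rewrite (inj_eq (can_inj fK)).
    by move: nc; rewrite /connected -!edgef -!arrowf.
  - by apply: HK_edge; rewrite edgef.
  - by apply: HK_arrow_l; rewrite arrowf.
  - by apply: HK_arrow_r; rewrite arrowf.
(* The word is acbd: it completes one block of each kind, so the count grows by two. *)
pose abcd : seq K := [:: inord 0; inord 2; inord 1; inord 3].
pose pow n := map g (flatten (nseq n abcd)).
have evE n : ev (pow n) = Some (n.*2, 0).
  rewrite /ev /pow mapK //.
  suff evm m : foldl K_act (Some (m.*2, 0)) (flatten (nseq n abcd)) =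
      Some ((m + n).*2, 0) by exact: (evm 0).
  elim: n m => [|n IHn] m; first by rewrite addn0.
  rewrite [flatten _]/= -[_ :: _]/(abcd ++ _) foldl_cat.
  have -> : foldl K_act (Some (m.*2, 0)) abcd = Some (m.+1.*2, 0).
    by rewrite /K_act /= !inordK //=; do 4?rewrite odd_double /=.
  by rewrite IHn addSnnS.
move=> finQ; apply: infinite_nat.
have -> : [set: nat]%classic =
    ((fun n => \pi_(HK_monoid Q)%qT (pow n)) @^-1` setT)%classic by [].
apply: finite_preimage finQ => m n _ _ /presented_eqP/ev_congr.
by rewrite !evE => -[/double_inj].
Qed.

(** No side leads from {c, d} back to {a, b}, so a cycle stays within one of these pairs, which is
    too small for three distinct vertices. *)
Lemma acyclic_K : acyclic K.
Proof.
case=> s [s2 /andP[cyc us]].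
pose le_block : rel K := fun x y => (val x)./2 <= (val y)./2.
have tr : transitive le_block by move=> y x z; exact: leq_trans.
have /allrelP same : all2rel le_block s.
  rewrite -cycle_all2rel //; apply: sub_cycle cyc.
  by case=> [[|[|[|[|i]]]] hi] [[|[|[|[|j]]]] hj].
case: s s2 us same {cyc} => [|x [|y [|z s]]] //= _.
rewrite !inE !negb_or -!val_eqE /=.
move=> /andP[/and3P[xy xz _] /andP[/andP[yz _] _]] same.
have half u v : u \in [:: x, y, z & s] -> v \in [:: x, y, z & s] ->
    (val u)./2 = (val v)./2.
  by move=> us vs; apply/anti_leq/andP; split; apply: same.
have /= hy := half x y; have /= hz := half x z.
move: hy hz; rewrite !inE !eqxx !orbT => /(_ isT isT) hy /(_ isT isT) hz.
by move: xy xz yz hy hz => /=; lia.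
Qed.

(** * Classification of the digraphs on four vertices *)

Inductive side := Nothing | Edge | Forward | Backward.

Definition reverse (s : side) :=
  match s with Forward => Backward | Backward => Forward | _ => s end.

(* Indices out of range count as 0. *)
Definition entry (M : seq (seq side)) i j : side :=
  let row := nth (head [::] M) M i in nth (head Nothing row) row j.

Definition side_matrix s01 s02 s03 s12 s13 s23 : seq (seq side) :=
  [:: [:: Nothing; s01; s02; s03];
      [:: reverse s01; Nothing; s12; s13];
      [:: reverse s02; reverse s12; Nothing; s23];
      [:: reverse s03; reverse s13; reverse s23; Nothing]].

Definition is_edge M : rel nat :=
  fun i j => if entry M i j is Edge then true else false.
Definition is_arrow M : rel nat :=
  fun i j => if entry M i j is Forward then true else false.

Section Classification.
Variables ed ar : rel nat.

(** As [p] runs over the orderings of four vertices, [p] itself yields the 4-cycles and its tail the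
    3-cycles. *)
Definition has_cycle (p : seq nat) :=
  let e := fun i j => ed i j || ar i j in cycle e p || cycle e (behead p).

Definition is_K (p : seq nat) :=
  all (fun ij => (ed (nth 0 p ij.1) (nth 0 p ij.2) ==
                  (ij \in [:: (0, 1); (1, 0); (2, 3); (3, 2)])) &&
                 (ar (nth 0 p ij.1) (nth 0 p ij.2) ==
                  (ij \in [:: (0, 2); (0, 3); (1, 2); (1, 3)])))
    [seq (i, j) | i <- iota 0 4, j <- iota 0 4].

(** Either [v] is a source relative to [s], or it is a sink. *)
Definition terminal v (s : seq nat) :=
  all (fun j => ~~ ed v j && ~~ ar j v) s ||
  all (fun j => ~~ ed v j && ~~ ar v j) s.

Definition reducible (p : seq nat) :=
  if p is [:: i, j & s] then
    terminal i (j :: s) &&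
    (dominated ed ar A3 (nth 0 (j :: s)) ||
     (terminal j s && dominated ed ar A2 (nth 0 s)))
  else false.

Definition finite_shape (p : seq nat) :=
  [|| dominated ed ar A4 (nth 0 p), dominated ed ar D4 (nth 0 p),
      dominated ed ar K_minus (nth 0 p) | reducible p].

Definition classified :=
  has has_cycle (permutations (iota 0 4)) ||
  has (fun p => is_K p || finite_shape p) (permutations (iota 0 4)).

End Classification.

Definition sides := [:: Nothing; Edge; Forward; Backward].

(** Six pairs with four possible sides each make 4096 labelled digraphs. *)
Definition all_classified :=
  all (fun s01 => all (fun s02 => all (fun s03 => all (fun s12 => all (fun s13 =>
    all (fun s23 =>
      let M := side_matrix s01 s02 s03 s12 s13 s23 in
      classified (is_edge M) (is_arrow M))
    sides) sides) sides) sides) sides) sides.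

Lemma all_classifiedT : all_classified.
(* Unlike [vm_compute], [lazy] does not evaluate both sides of [||]. *)
Proof. by lazy. Qed.

(** * Transfer of the enumeration to a digraph with four listed vertices *)

Section FourVertices.
Variable Q : digraph.

Definition side_of (x y : Q) : side :=
  if edge x y then Edge else if arrow x y then Forward
  else if arrow y x then Backward else Nothing.

Lemma side_ofE (x y : Q) :
  (edge x y = if side_of x y is Edge then true else false) /\
  (arrow x y = if side_of x y is Forward then true else false).
Proof.
rewrite /side_of; case e: (edge x y); case a: (arrow x y) => //=.
- by have := digraph_arrow_side a; rewrite e andbF.
- by case: ifP.
Qed.

Lemma side_ofC (x y : Q) : side_of y x = reverse (side_of x y).
Proof.
rewrite /side_of digraph_edge_sym; case: ifP => // _.
case: ifP => [/digraph_arrow_side/andP[/negbTE-> _] //|_].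
by case: ifP.
Qed.

Lemma side_of_loop (x : Q) : side_of x x = Nothing.
Proof.
rewrite /side_of digraph_edge_irr.
by case a: (arrow x x) => //; have := digraph_arrow_side a; rewrite a.
Qed.

Variables x0 x1 x2 x3 : Q.
Let f := nth x0 [:: x0; x1; x2; x3].

Definition digraph_matrix :=
  side_matrix (side_of x0 x1) (side_of x0 x2) (side_of x0 x3)
    (side_of x1 x2) (side_of x1 x3) (side_of x2 x3).

(** Out of range, [f] gives [x0] and [entry] falls back to index 0. The agreement for all naturals
    allows equalities of relations below. *)
Lemma entry_digraph_matrix i j : entry digraph_matrix i j = side_of (f i) (f j).
Proof.
rewrite /digraph_matrix /side_matrix -!side_ofC /entry /f.
by case: i => [|[|[|[|[|i]]]]]; case: j => [|[|[|[|[|j]]]]] //=;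
  rewrite side_of_loop.
Qed.

Lemma matrix_edge : is_edge digraph_matrix = relpre f (@edge Q).
Proof.
apply/funext => i; apply/funext => j.
by rewrite /is_edge entry_digraph_matrix /= (side_ofE _ _).1.
Qed.

Lemma matrix_arrow : is_arrow digraph_matrix = relpre f (@arrow Q).
Proof.
apply/funext => i; apply/funext => j.
by rewrite /is_arrow entry_digraph_matrix /= (side_ofE _ _).2.
Qed.

Lemma classifiedT : classified (relpre f (@edge Q)) (relpre f (@arrow Q)).
Proof.
rewrite -matrix_edge -matrix_arrow /digraph_matrix.
have in_sides (s : side) (p : pred side) : all p sides -> p s.
  by case: s => /=; case/and5P.
have := all_classifiedT; rewrite /all_classified.
move/(in_sides (side_of x0 x1))/(in_sides (side_of x0 x2)).
move/(in_sides (side_of x0 x3))/(in_sides (side_of x1 x2)).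
by move/(in_sides (side_of x1 x3))/(in_sides (side_of x2 x3)).
Qed.

Hypotheses (uniq_x : uniq [:: x0; x1; x2; x3])
  (all_x : forall x, x \in [:: x0; x1; x2; x3]).

Let f_inj i j : i < 4 -> j < 4 -> f i = f j -> i = j.
Proof. by move=> i4 j4 /eqP; rewrite nth_uniq // => /eqP. Qed.

Lemma acyclic_has_cycle p : acyclic Q -> perm_eq p (iota 0 4) ->
  ~~ has_cycle (relpre f (@edge Q)) (relpre f (@arrow Q)) p.
Proof.
move=> acycQ pP; apply/negP=> cyc; apply: acycQ.
have pu : uniq (map f p).
  by rewrite (perm_uniq (perm_map f pP)).
have p4 := perm_size pP; case: p => // i p in cyc pP pu p4 *.
case/orP: cyc => cyc.
  exists (map f (i :: p)); rewrite size_map p4; split=> //.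
  by apply/andP; split; rewrite // cycle_map.
exists (map f p); rewrite size_map; split; first by move: p4 => /= [->].
by apply/andP; split; [by rewrite cycle_map|];
  case/andP: pu.
Qed.

Lemma is_K_iso p : perm_eq p (iota 0 4) ->
  is_K (relpre f (@edge Q)) (relpre f (@arrow Q)) p -> digraph_iso Q K.
Proof.
move=> pP /allP isK.
have p4 : size p = 4 := perm_size pP.
have pu : uniq p by rewrite (perm_uniq pP) iota_uniq.
have plt i : i < 4 -> nth 0 p i < 4.
  by move=> i4; have := mem_nth 0 (_ : i < size p);
     rewrite p4 (perm_mem pP) mem_iota => /(_ i4).
pose g (i : K) : Q := f (nth 0 p (val i)).
have g_inj : injective g.
  move=> i j /f_inj => /(_ (plt _ (ltn_ord i)) (plt _ (ltn_ord j))) /eqP.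
  by rewrite nth_uniq ?p4 ?ltn_ord // => /eqP/val_inj.
have cardQ : #|Q| = 4.
  apply: etrans (card_uniqP uniq_x); apply: eq_card => x.
  by rewrite all_x.
(* The isomorphism sought is the inverse [h] of the labelling [g]. *)
have [h gK hK] : bijective g by apply: inj_card_bij; rewrite // cardQ card_ord.
have gE (i j : K) :
    edge (g i) (g j) = edge i j /\ arrow (g i) (g j) = arrow i j.
  have /isK/andP[/eqP ee /eqP aa] : (val i, val j) \in
      [seq (i, j) | i <- iota 0 4, j <- iota 0 4].
    by apply: allpairs_f; rewrite mem_iota ltn_ord.
  by split.
exists h; split; first by exists g.
- by move=> x y; rewrite -(gE _ _).2 !hK.
- by move=> x y; rewrite -(gE _ _).1 !hK.
Qed.

Lemma span_finite_terminal (S : seq nat) i :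
  terminal (relpre f (@edge Q)) (relpre f (@arrow Q)) i S ->
  span_finite (fun x => x \in map f S) ->
  span_finite (fun x => x \in map f (i :: S)).
Proof.
move=> ter finS.
apply: (@sub_span_finite _ _ (predU1 (f i) (fun x => x \in map f S))) => [x|].
  by rewrite inE.
by case/orP: ter => /allP ter;
  [apply: span_finite_source | apply: span_finite_sink] => // _ /mapP[j /ter ? ->].
Qed.

Lemma span_finite_shape p : perm_eq p (iota 0 4) ->
  finite_shape (relpre f (@edge Q)) (relpre f (@arrow Q)) p ->
  span_finite (predT : pred Q).
Proof.
move=> pP shape.
have p4 : size p = 4 := perm_size pP.
apply: (@sub_span_finite _ _ (fun x => x \in map f p)) => [x _|].
  have /(nthP x0)[i i4 <-] := all_x x.
  by apply: map_f; rewrite (perm_mem pP) mem_iota.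
have dom P s : finite_pattern P -> size s = psize P ->
    dominated (relpre f (@edge Q)) (relpre f (@arrow Q)) P (nth 0 s) ->
    span_finite (fun x => x \in map f s).
  move=> finP sP /(@dominated_span_finite Q P (f \o nth 0 s) finP).
  by rewrite map_comp -sP map_nth_iota0 // take_size.
case/or4P: shape.
- exact: dom finite_A4 p4.
- exact: dom finite_D4 p4.
- exact: dom finite_K_minus p4.
(* Removing [i] leaves three vertices for [A3]; removing [j] as well leaves two for [A2]. *)
case: p p4 {pP} => [|i [|j s]] //= [s2] /andP[/span_finite_terminal ti fin].
apply: ti; case/orP: fin => [|/andP[/span_finite_terminal tj A2s]].
  by apply: dom finite_A3 _; rewrite /= s2.
by apply: tj; apply: dom finite_A2 s2 A2s.
Qed.

Lemma iso_or_finite : acyclic Q -> digraph_iso Q K \/ ~ infinite_type Q.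
Proof.
move=> acycQ; case/orP: classifiedT => /hasP[p].
  by rewrite mem_permutations => /acyclic_has_cycle-/(_ acycQ)/negP.
rewrite mem_permutations => pP /orP[/(is_K_iso pP)|]; first by left.
by right; apply/span_finite_predT/(span_finite_shape pP).
Qed.

End FourVertices.

Theorem theorem3p6 :
  [/\ #|K| = 4, acyclic K &
      forall Q : digraph, #|Q| = 4 -> acyclic Q ->
        (infinite_type Q <-> digraph_iso Q K)].
Proof.
split; [exact: card_ord | exact: acyclic_K | move=> Q Q4 acycQ].
split; last exact: iso_K_infinite.
have := enum_uniq Q; have := mem_enum Q; have := cardE Q; rewrite Q4.
case: (enum Q) => [|x0 [|x1 [|x2 [|x3 []]]]] // _ all_x uniq_x infQ.
by case: (iso_or_finite uniq_x all_x acycQ).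
Qed.
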